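(* Fix the space steps $\Delta x,\Delta y>0$ and the time step $\Delta t>0$, and fix the discrete data at time $t_n$: realizable moments $\mathbf{U}_{i,j}^n(v)$, positive macroscopic states $\mathbf{W}_{i,j}^n=(\rho_{i,j}^n,q_{i,j}^n)^T$ and bounded opacities. Put $\eta=\epsilon$. Then the UGKS-M1 scheme (first order or second order in space) is asymptotic preserving at the level of its macroscopic numerical fluxes: as $\epsilon\to0$, the fluxes $\Phi^\rho_{i+1/2,j}$ and $\Phi^q_{i+1/2,j}$ of UGKS-M1 satisfy $$\Phi^\rho_{i+1/2,j}\longrightarrow -\frac{2}{3\sigma_{i+1/2,j}}\,\frac{q_{i+1,j}^n-q_{i,j}^n}{\Delta x},$$ $$\Phi^q_{i+1/2,j}\longrightarrow -\frac{2}{3\sigma_{i+1/2,j}}\,\frac{5(q_{i+1/2,j}^n)^2}{3\rho_{i+1/2,j}^n}\left(-\frac{1}{\rho_{i+1/2,j}^n}\frac{\rho_{i+1,j}^n-\rho_{i,j}^n}{\Delta x}+\frac{2}{q_{i+1/2,j}^n}\frac{q_{i+1,j}^n-q_{i,j}^n}{\Delta x}\right).$$ These are discretizations of the $x$-components of the fluxes of the limit diffusion system $\partial_t\rho=\nabla_{\mathbf{x}}\cdot\left(\frac{2}{3\sigma}\nabla_{\mathbf{x}}q\right)$, $\partial_t q=\nabla_{\mathbf{x}}\cdot\left(\frac53\frac{2}{3\sigma}\nabla_{\mathbf{x}}\frac{q^2}{\rho}\right)$.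
   Context: Notation: $\mathbb{S}^2$ is the unit sphere of $\mathbb{R}^3$, $v\in\mathbb{R}_+$ the speed, $\boldsymbol\Omega=(\Omega_x,\Omega_y,\Omega_z)\in\mathbb{S}^2$ the direction. Set $\langle g\rangle=\int_{\mathbb{S}^2}g\,d\Omega$ and $\langle\langle g\rangle\rangle=\int_{\mathbb{S}^2}\int_{\mathbb{R}_+}g\,v^2\,dv\,d\Omega$. Let $\mathbf{m}(\boldsymbol\Omega)=(1,\boldsymbol\Omega)^T\in\mathbb{R}^4$. The underlying kinetic equation is $\partial_t f+\frac{v}{\eta}\boldsymbol\Omega\cdot\nabla_{\mathbf{x}}f=\nu(M[f]-f)$ with $\nu=\frac{\sigma}{\epsilon\eta}$, where $\sigma=C\rho/T^{3/2}$ ($C>0$ constant) is the opacity, $q=\frac32\rho T$, and $M[f]$ is the Maxwellian $\frac{\rho}{(2\pi T)^{3/2}}e^{-v^2/(2T)}$ with the same moments $\mathbf{W}=(\rho,q)^T=\langle\langle(1,\frac12v^2)^Tf\rangle\rangle$ as $f$. M1 closure. A vector $\mathbf{U}=(f_0,\mathbf{f}_1)^T$ with $f_0>0$ and $u:=\|\mathbf{f}_1\|/f_0<1$ is realizable, as is $\mathbf{U}=0$. For $f_0>0$, $\hat f[\mathbf{U}](\boldsymbol\Omega)=e^{\boldsymbol\Lambda\cdot\mathbf{m}(\boldsymbol\Omega)}$, $\boldsymbol\Lambda=\boldsymbol\Lambda(\mathbf{U})\in\mathbb{R}^4$, is the unique function of this form with $\langle\mathbf{m}\hat f[\mathbf{U}]\rangle=\mathbf{U}$;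 $\hat f[0]=0$. Write $\hat f_{i,j}^n(v,\boldsymbol\Omega)=\hat f[\mathbf{U}_{i,j}^n(v)](\boldsymbol\Omega)$. Cells are $C_{i,j}$ of size $\Delta x\times\Delta y$; $\mathbf{W}_{i,j}^n$ is the macroscopic state in $C_{i,j}$ at time $t_n$. Interface quantities are arithmetic means: $\mathbf{W}_{i+1/2,j}^n=\frac12(\mathbf{W}_{i,j}^n+\mathbf{W}_{i+1,j}^n)=(\rho^n_{i+1/2,j},q^n_{i+1/2,j})^T$, $\sigma_{i+1/2,j}=\frac12(\sigma_{i,j}+\sigma_{i+1,j})>0$. With $w=-\frac{\sigma_{i+1/2,j}}{\epsilon\eta}\Delta t$, the integration coefficients are $$A=-\frac1\eta\frac{1-e^w}{w},\quad B=\frac{\epsilon}{\sigma_{i+1/2,j}\eta}\Big(e^w+\frac{1-e^w}{w}\Big),\quad D=-\frac{\epsilon}{\sigma_{i+1/2,j}\eta}\Big(1+e^w+2\frac{1-e^w}{w}\Big).$$ Macroscopic fluxes of first-order UGKS-M1 (at the interface $(i+1/2,j)$): $$\Phi^\rho_{i+1/2,j}=A\langle\langle v\Omega_x\hat f_{i,j}^n\mathbb{1}_{\Omega_x>0}+v\Omega_x\hat f_{i+1,j}^n\mathbb{1}_{\Omega_x<0}\rangle\rangle+\frac{2D}{3\Delta x}(q_{i+1,j}^n-q_{i,j}^n),$$ $$\Phi^q_{i+1/2,j}=\frac A2\langle\langle v^3\Omega_x\hat f_{i,j}^n\mathbb{1}_{\Omega_x>0}+v^3\Omega_x\hat f_{i+1,j}^n\mathbb{1}_{\Omega_x<0}\rangle\rangle+\frac{2D}{3\Delta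 x}\frac{5(q_{i+1/2,j}^n)^2}{3\rho_{i+1/2,j}^n}\Big(-\frac{\rho_{i+1,j}^n-\rho_{i,j}^n}{\rho_{i+1/2,j}^n}+2\frac{q_{i+1,j}^n-q_{i,j}^n}{q_{i+1/2,j}^n}\Big).$$ Second-order UGKS-M1: to the vector $(\Phi^\rho,\Phi^q)^T$ above one adds, with $\boldsymbol\Psi(v)=(1,\frac12v^2)^T$, $$A\frac{\Delta x}{2}\langle\langle v\boldsymbol\Psi\Omega_x(\delta_x\hat f_{i,j}^n\mathbb{1}_{\Omega_x>0}-\delta_x\hat f_{i+1,j}^n\mathbb{1}_{\Omega_x<0})\rangle\rangle+B\langle\langle v^2\boldsymbol\Psi\Omega_x^2(\delta_x\hat f_{i,j}^n\mathbb{1}_{\Omega_x>0}+\delta_x\hat f_{i+1,j}^n\mathbb{1}_{\Omega_x<0})\rangle\rangle,$$ where $\delta_x\hat f_{i,j}^n=\big(\mathbf{J}_{\boldsymbol\Lambda}(\mathbf{U}_{i,j}^n)\,\boldsymbol\delta_x\mathbf{U}_{i,j}^n\big)\cdot\mathbf{m}\,\hat f_{i,j}^n$, $\mathbf{J}_{\boldsymbol\Lambda}$ is the Jacobian matrix of $\mathbf{U}\mapsto\boldsymbol\Lambda(\mathbf{U})$, and $\boldsymbol\delta_x\mathbf{U}_{i,j}^n$ is a slope-limited finite difference (given data independent of $\epsilon$). All the velocity moments appearing in the fluxes are assumed finite. *)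

(* Defs.v *)
From HB Require Import structures.
From mathcomp Require Import all_boot all_order all_algebra.
From mathcomp Require Import all_classical all_reals all_analysis.
Set Implicit Arguments.
Unset Strict Implicit.
Unset Printing Implicit Defensive.
Import Order.TTheory GRing.Theory Num.Theory.
Import numFieldNormedType.Exports.
Local Open Scope classical_set_scope.
Local Open Scope ring_scope.

(* Directions Omega are row vectors of length 3.  The unit sphere is
   parametrized by z = (theta, phi) in [0, pi] x [0, 2 pi], with surface
   measure sin(theta) dtheta dphi. *)
Definition sph (R : realType) (z : R * R) : 'rV[R]_3 :=
  \row_(k < 3) nth 0 [:: sin z.1 * cos z.2; sin z.1 * sin z.2; cos z.1] k.

Definition sph_dom (R : realType) : set (R * R) :=
  `[0, pi] `*` `[0, 2 * pi].

(* <g> *)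
Definition sphere_int (R : realType) (g : 'rV[R]_3 -> R) : R :=
  \int[(lebesgue_measure \x lebesgue_measure)%E]_(z in @sph_dom R)
     (g (sph z) * sin z.1).

(* <<g>>, for g a function of (v, Omega) *)
Definition kin_int (R : realType) (g : R -> 'rV[R]_3 -> R) : R :=
  sphere_int (fun O => \int[lebesgue_measure]_(v in `[0, +oo[) (g v O * v ^+ 2)).

(* <<|g|>> is finite: absolute integrability over the product R_+ x S^2 *)
Definition finite_moment (R : realType) (g : R -> 'rV[R]_3 -> R) : Prop :=
  (lebesgue_measure \x (lebesgue_measure \x lebesgue_measure))%E.-integrable
    (`[0, +oo[ `*` @sph_dom R)
    (fun p : R * (R * R) => (g p.1 (sph p.2) * p.1 ^+ 2 * sin p.2.1)%:E).

(* Moment vectors U = (f_0, f_1) are row vectors of length 4 = 1 + 3. *)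
Definition mvec (R : realType) (O : 'rV[R]_3) : 'rV[R]_4 :=
  row_mx (const_mx 1 : 'rV[R]_1) O.

Definition dotp (R : realType) n (a b : 'rV[R]_n) : R :=
  \sum_(k < n) a 0 k * b 0 k.

Definition U0 (R : realType) (U : 'rV[R]_4) : R := U 0 ord0.
Definition U1 (R : realType) (U : 'rV[R]_4) : 'rV[R]_3 :=
  rsubmx (U : 'rV[R]_(1 + 3)).

(* The library's norm on matrices is the sup norm, hence the explicit
   Euclidean norm of f_1. *)
Definition realizable (R : realType) (U : 'rV[R]_4) : Prop :=
  U = 0 \/
  (0 < U0 U /\ Num.sqrt (dotp (U1 U) (U1 U)) / U0 U < 1).

(* Lambda(U): the L such that <m e^{L.m}> = U *)
Definition Lambda (R : realType) (U : 'rV[R]_4) : 'rV[R]_4 :=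
  xget 0 [set L : 'rV[R]_4 |
    \row_(k < 4) sphere_int (fun O => mvec O 0 k * expR (dotp L (mvec O))) = U].

Definition fhat (R : realType) (U : 'rV[R]_4) (O : 'rV[R]_3) : R :=
  if U == 0 then 0 else expR (dotp (Lambda U) (mvec O)).

(* (J_Lambda(U) dU) . m  fhat[U]; the library's Jacobian acts on row vectors
   from the right *)
Definition dfhat (R : realType) (U dU : 'rV[R]_4) (O : 'rV[R]_3) : R :=
  dotp (dU *m jacobian (@Lambda R) U) (mvec O) * fhat U O.

(* Macroscopic state W = (rho, q) *)
Record macro (R : realType) := Macro { rho : R ; q : R }.

Definition mean (R : realType) (a b : R) : R := (a + b) / 2.

Definition mid (R : realType) (WL WR : macro R) : macro R :=
  Macro (mean (rho WL) (rho WR)) (mean (q WL) (q WR)).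

(* q = 3/2 rho T *)
Definition temperature (R : realType) (W : macro R) : R :=
  2 * q W / (3 * rho W).

Definition opacity (R : realType) (C : R) (W : macro R) : R :=
  C * rho W / (temperature W `^ (3 / 2)).

Definition opacity_mid (R : realType) (C : R) (WL WR : macro R) : R :=
  mean (opacity C WL) (opacity C WR).

Section Coefficients.
Context (R : realType).
Variables (dt eps eta sigma : R).

Definition wexp : R := - (sigma / (eps * eta)) * dt.

Definition Acoef : R := - (1 / eta) * ((1 - expR wexp) / wexp).

Definition Bcoef : R :=
  eps / (sigma * eta) * (expR wexp + (1 - expR wexp) / wexp).

Definition Dcoef : R :=
  - (eps / (sigma * eta)) * (1 + expR wexp + 2 * ((1 - expR wexp) / wexp)).

End Coefficients.

(* g 1_{Omega_x > 0} + h 1_{Omega_x < 0} *)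
Definition upwind (R : realType) (g h : R -> 'rV[R]_3 -> R)
    (v : R) (O : 'rV[R]_3) : R :=
  g v O * (0 < O 0 0)%R%:R + h v O * (O 0 0 < 0)%R%:R.

Inductive space_order := FirstOrder | SecondOrder.

(* Fluxes at the interface between a left cell, with data WL, UL(v), dUL(v),
   and a right cell, with data WR, UR(v), dUR(v). *)
Section Fluxes.
Context (R : realType).
Variables (dx dt C : R).
Variables (WL WR : macro R) (UL UR dUL dUR : R -> 'rV[R]_4).

Let fL v O := fhat (UL v) O.
Let fR v O := fhat (UR v) O.
Let dfL v O := dfhat (UL v) (dUL v) O.
Let dfR v O := dfhat (UR v) (dUR v) O.

(* Integrands of the moments; psi is one of the two components 1, v^2/2
   of the vector Psi. *)
Definition transport_rho (v : R) (O : 'rV[R]_3) : R :=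
  v * O 0 0 * upwind fL fR v O.

Definition transport_q (v : R) (O : 'rV[R]_3) : R :=
  v ^+ 3 * O 0 0 * upwind fL fR v O.

Definition slopeA (psi : R -> R) (v : R) (O : 'rV[R]_3) : R :=
  v * psi v * O 0 0 * upwind dfL (fun v O => - dfR v O) v O.

Definition slopeB (psi : R -> R) (v : R) (O : 'rV[R]_3) : R :=
  v ^+ 2 * psi v * O 0 0 ^+ 2 * upwind dfL dfR v O.

Definition psi_rho : R -> R := fun=> 1.
Definition psi_q : R -> R := fun v => v ^+ 2 / 2.

Definition finite_flux_moments (ord : space_order) : Prop :=
  finite_moment transport_rho /\ finite_moment transport_q /\
  if ord is SecondOrder then
    finite_moment (slopeA psi_rho) /\ finite_moment (slopeA psi_q) /\
    finite_moment (slopeB psi_rho) /\ finite_moment (slopeB psi_q)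
  else True.

Let sigma := opacity_mid C WL WR.
Let Wm := mid WL WR.

Definition second_order_term (eps eta : R) (psi : R -> R) : R :=
  Acoef dt eps eta sigma * (dx / 2) * kin_int (slopeA psi)
  + Bcoef dt eps eta sigma * kin_int (slopeB psi).

Definition flux_rho (ord : space_order) (eps eta : R) : R :=
  Acoef dt eps eta sigma * kin_int transport_rho
  + 2 * Dcoef dt eps eta sigma / (3 * dx) * (q WR - q WL)
  + if ord is SecondOrder then second_order_term eps eta psi_rho else 0.

Definition flux_q (ord : space_order) (eps eta : R) : R :=
  Acoef dt eps eta sigma / 2 * kin_int transport_q
  + 2 * Dcoef dt eps eta sigma / (3 * dx)
    * (5 * q Wm ^+ 2 / (3 * rho Wm))
    * (- ((rho WR - rho WL) / rho Wm) + 2 * ((q WR - q WL) / q Wm))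
  + if ord is SecondOrder then second_order_term eps eta psi_q else 0.

Definition limit_flux_rho : R :=
  - (2 / (3 * sigma)) * ((q WR - q WL) / dx).

Definition limit_flux_q : R :=
  - (2 / (3 * sigma)) * (5 * q Wm ^+ 2 / (3 * rho Wm))
  * (- (1 / rho Wm * ((rho WR - rho WL) / dx))
     + 2 / q Wm * ((q WR - q WL) / dx)).

End Fluxes.

(* The numerical flux F, a function of the space step and of the states in
   the two adjacent cells, is a consistent discretization of the x-component
   Fx of a flux: evaluated at the centres (x - h/2, y) and (x + h/2, y) of two
   adjacent cells, it tends to Fx at the interface point (x, y) as h -> 0, for
   all positive fields having an x-derivative there. *)
Definition consistent_x (R : realType) (F : R -> macro R -> macro R -> R)
    (Fx : (R -> R -> macro R) -> R -> R -> R) : Prop :=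
  forall (W : R -> R -> macro R) (x y : R),
    (forall x' y', 0 < rho (W x' y') /\ 0 < q (W x' y')) ->
    derivable (fun t : R => rho (W t y)) x 1 ->
    derivable (fun t : R => q (W t y)) x 1 ->
    F h (W (x - h / 2) y) (W (x + h / 2) y) @[h --> 0^'+] --> Fx W x y.

(* x-components of the fluxes of the limit diffusion system, written
   d_t W + div F = 0 *)
Definition diffusion_flux_rho (R : realType) (C : R)
    (W : R -> R -> macro R) (x y : R) : R :=
  - (2 / (3 * opacity C (W x y)) * derive1 (fun t : R => q (W t y)) x).

Definition diffusion_flux_q (R : realType) (C : R)
    (W : R -> R -> macro R) (x y : R) : R :=
  - (5 / 3 * (2 / (3 * opacity C (W x y)))
     * derive1 (fun t : R => q (W t y) ^+ 2 / rho (W t y)) x).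

(* Main.v *)
Require Import Defs.
From HB Require Import structures.
From mathcomp Require Import all_boot all_order all_algebra.
From mathcomp Require Import all_classical all_reals all_analysis.
From mathcomp Require Import ring.
Set Implicit Arguments.
Unset Strict Implicit.
Unset Printing Implicit Defensive.
Import Order.TTheory GRing.Theory Num.Theory.
Import numFieldNormedType.Exports.
Local Open Scope classical_set_scope.
Local Open Scope ring_scope.

(** The scheme depends on [eps] only through its three integration
coefficients; the velocity moments they multiply are fixed real numbers.  With
[eta = eps] the exponent is [w = - sigma dt / eps^2], which tends to [-oo], so
[e^w] tends to 0, and [(1 - e^w) / w] is [- eps^2 (1 - e^w) / (sigma dt)],
which is of order [eps^2].  The coefficient [A] contains one factor [1 / eps]
and is therefore of order [eps]; [B] and [D] have the prefactor [1 / sigma], so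
that [B] tends to 0 and [D] to [- 1 / sigma] ([cvg_Acoef], [cvg_Bcoef],
[cvg_Dcoef]).  Hence the transport and slope terms, of both orders, disappear,
and the [D] terms become the diffusion fluxes ([cvg_flux_rho], [cvg_flux_q]).

The limit fluxes are consistent because the difference quotient across the
interface is a central one, which converges to the derivative at the interface
point as soon as this derivative exists ([cvg_central_diff]), while the
interface means converge by continuity ([cvg_mean], [cvg_opacity_mid]).  For
[q] the limit is then [(5 q^2 / (3 rho)) (- rho' / rho + 2 q' / q)], which the
quotient rule identifies with [(5 / 3) (q^2 / rho)'] ([derive1_sqr_div]). *)

(** * Limits at 0 from the right *)

(** As [e * e / k] tends to 0 through positive values, its inverse tends to
[+oo], where [expR (- t)] vanishes. *)
Lemma cvg_expR_stiff (R : realType) (k : R) : 0 < k ->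
  expR (- (k / (e * e))) @[e --> 0^'+] --> (0 : R).
Proof.
move=> k0; apply: (@cvg_comp _ _ _ (fun e : R => k / (e * e)) (fun t => expR (- t))
  _ +oo); last exact: cvgr_expR.
have e0 : (e : R) @[e --> (0:R)^'+] --> (0 : R) by exact/cvg_at_right_filter/cvg_id.
apply/gtr0_cvgV0.
  near=> e; rewrite divr_gt0// mulr_gt0//.
rewrite [X in X @ _](_ : _ = fun e => e * e / k); last first.
  by apply/funext => e /=; rewrite invf_div.
rewrite [X in _ --> X](_ : 0 = 0 * 0 / k); last by rewrite !mul0r.
by apply: cvgM; [exact: (cvgM e0 e0)|exact: cvg_cst].
Unshelve. all: by end_near. Qed.

(** Allows the two one-sided steps [h / 2] and [- h / 2] to be substituted in
the limit that defines a derivative. *)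
Lemma cvg_at_right0_dnbhs (R : realType) (a : R) : a != 0 ->
  a * h @[h --> 0^'+] --> (0 : R)^'.
Proof.
move=> a0.
have ah0 : a * h @[h --> (0 : R)^'+] --> (0 : R).
  rewrite -[X in _ --> X](mulr0 a); apply: cvgM; first exact: cvg_cst.
  exact/cvg_at_right_filter/cvg_id.
move=> P /ah0 P0; change (\forall h \near (0 : R)^'+, P (a * h)).
near=> h; suff: a * h != 0 -> P (a * h) by apply; rewrite mulf_neq0// gt_eqF.
by near: h; exact: P0.
Unshelve. all: by end_near. Qed.

(** The central quotient is the average of the difference quotients of steps
[h / 2] and [- h / 2]; differentiability at the single point [x] suffices. *)
Lemma cvg_central_diff (R : realType) (f : R -> R) (x : R) : derivable f x 1 ->
  (f (x + h / 2) - f (x - h / 2)) / h @[h --> 0^'+] --> derive1 f x.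
Proof.
move=> df; rewrite derive1E.
set g := fun h : R => h^-1 *: ((f \o shift x) (h *: 1) - f x).
have gx : g h @[h --> 0^'] --> 'D_1 f x by exact: df.
have half0 : 2^-1 != 0 :> R by rewrite invr_eq0.
have gP := cvg_comp _ _ (cvg_at_right0_dnbhs half0) gx.
have nhalf0 : - 2^-1 != 0 :> R by rewrite oppr_eq0.
have gN := cvg_comp _ _ (cvg_at_right0_dnbhs nhalf0) gx.
have -> : 'D_1 f x = 2^-1 * 'D_1 f x + 2^-1 * 'D_1 f x by field.
have half_cvg : cst (2^-1 : R) h @[h --> (0 : R)^'+] --> (2^-1 : R) by exact: cvg_cst.
apply: cvg_trans (cvgD (cvgM half_cvg gP) (cvgM half_cvg gN)).
apply: near_eq_cvg; near=> h.
have h0 : h != 0 by rewrite gt_eqF.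
have gE t : g t = t^-1 * (f (x + t) - f x) by rewrite [x + t]addrC /g /= [t%:A]mulr1.
transitivity (2^-1 * g (2^-1 * h) + 2^-1 * g (- 2^-1 * h)); first by [].
rewrite !gE mulNr [2^-1 * h]mulrC.
set a := f (x + _); set b := f (x - _).
by clearbody a b; field.
Unshelve. all: by end_near. Qed.

Lemma cvg_half_shift (R : realType) (f : R -> R) (x : R) : derivable f x 1 ->
  f (x + h / 2) @[h --> 0^'+] --> f x /\ f (x - h / 2) @[h --> 0^'+] --> f x.
Proof.
move=> /derivable1_diffP/differentiable_continuous fx.
have h0 : h / 2 @[h --> (0:R)^'+] --> (0 : R).
  rewrite -[X in _ --> X](mul0r 2^-1); apply: cvgM; last exact: cvg_cst.
  exact/cvg_at_right_filter/cvg_id.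
have xP : x + h / 2 @[h --> (0 : R)^'+] --> x + 0 by apply: cvgD => //; exact: cvg_cst.
have xN : x - h / 2 @[h --> (0 : R)^'+] --> x - 0 by apply: cvgB => //; exact: cvg_cst.
rewrite addr0 in xP; rewrite subr0 in xN.
by split; [exact: cvg_comp xP fx|exact: cvg_comp xN fx].
Qed.

Lemma cvg_mean (R : realType) (F : set_system R) {FF : Filter F} (f g : R -> R) (a : R) :
  f @ F --> a -> g @ F --> a -> mean (f h) (g h) @[h --> F] --> a.
Proof.
move=> fa ga; have -> : a = (a + a) / 2 by field.
by apply: cvgM; [exact: cvgD|exact: cvg_cst].
Qed.

(** * Opacity *)

(** Positivity of the limit state keeps both the denominator of the temperature
and the base of the real power [T `^ (3 / 2)] away from 0. *)
Lemma cvg_opacity (R : realType) (F : set_system R) {FF : Filter F} (C : R)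
    (V : R -> macro R) (W : macro R) :
  0 < rho W -> 0 < q W ->
  rho (V h) @[h --> F] --> rho W -> q (V h) @[h --> F] --> q W ->
  opacity C (V h) @[h --> F] --> opacity C W.
Proof.
move=> rho0 q0 Vrho Vq.
have T0 : 0 < temperature W by rewrite divr_gt0 ?mulr_gt0.
have VT : temperature (V h) @[h --> F] --> temperature W.
  apply: cvgM; first by apply: cvgM => //; exact: cvg_cst.
  apply: cvgV; first by rewrite mulf_neq0// gt_eqF.
  by apply: cvgM => //; exact: cvg_cst.
apply: cvgM; first by apply: cvgM => //; exact: cvg_cst.
apply: cvgV; first by rewrite gt_eqF ?powR_gt0.
have powR_cvg : {for temperature W, continuous (fun t => t `^ (3 / 2))}.
  apply: differentiable_continuous; apply/derivable1_diffP/derivable_powR.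
  by rewrite in_itv/= andbT.
exact: cvg_comp VT powR_cvg.
Qed.

Lemma opacity_gt0 (R : realType) (C : R) (W : macro R) :
  0 < C -> 0 < rho W -> 0 < q W -> 0 < opacity C W.
Proof.
by move=> C0 r0 q0; rewrite /opacity divr_gt0 ?mulr_gt0 ?powR_gt0 ?divr_gt0 ?mulr_gt0.
Qed.

(** * Integration coefficients in the diffusive scaling *)

Section coefficients.
Context (R : realType) (dt sigma : R).
Hypotheses (dt0 : 0 < dt) (sigma0 : 0 < sigma).

Let cvg_eps : (e : R) @[e --> (0:R)^'+] --> (0 : R).
Proof. exact/cvg_at_right_filter/cvg_id. Qed.

Lemma cvg_expR_wexp : expR (wexp dt e e sigma) @[e --> 0^'+] --> (0 : R).
Proof.
rewrite /wexp; under eq_fun do rewrite mulNr mulrAC.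
by apply: cvg_expR_stiff; rewrite mulr_gt0.
Qed.

(** Up to sign, [(1 - e^w) / w] is the mean of [e^t] over [w <= t <= 0]; this
form exhibits its order [e^2], from which one factor [e] remains once [Acoef] has
divided by [eta = e]. *)
Lemma average_wexpE (e : R) : e != 0 ->
  (1 - expR (wexp dt e e sigma)) / wexp dt e e sigma =
  - (e * e / (sigma * dt) * (1 - expR (wexp dt e e sigma))).
Proof.
move=> e0; set E := expR _; rewrite /wexp; field.
by rewrite e0 !gt_eqF.
Qed.

Lemma cvg_average_wexp :
  (1 - expR (wexp dt e e sigma)) / wexp dt e e sigma @[e --> 0^'+] --> (0 : R).
Proof.
have lim0 : - (e * e / (sigma * dt) * (1 - expR (wexp dt e e sigma)))
    @[e --> (0 : R)^'+] --> - (0 * 0 / (sigma * dt) * (1 - 0)).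
  apply: cvgN; apply: cvgM.
    by apply: cvgM; [exact: (cvgM cvg_eps cvg_eps)|exact: cvg_cst].
  by apply: cvgB; [exact: cvg_cst|exact: cvg_expR_wexp].
rewrite !mul0r oppr0 in lim0; apply: cvg_trans lim0.
by apply: near_eq_cvg; near=> e; rewrite -average_wexpE// gt_eqF.
Unshelve. all: by end_near. Qed.

Lemma cvg_Acoef : Acoef dt e e sigma @[e --> 0^'+] --> (0 : R).
Proof.
have lim0 : e / (sigma * dt) * (1 - expR (wexp dt e e sigma))
    @[e --> (0 : R)^'+] --> 0 / (sigma * dt) * (1 - 0).
  apply: cvgM; first by apply: cvgM; [exact: cvg_eps|exact: cvg_cst].
  by apply: cvgB; [exact: cvg_cst|exact: cvg_expR_wexp].
rewrite !mul0r in lim0; apply: cvg_trans lim0.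
apply: near_eq_cvg; near=> e.
have e0 : e != 0 by rewrite gt_eqF.
rewrite /Acoef average_wexpE//; set E := expR _; field.
by rewrite e0 !gt_eqF.
Unshelve. all: by end_near. Qed.

Lemma cvg_eps_ratio : e / (sigma * e) @[e --> 0^'+] --> sigma^-1.
Proof.
apply: (@cvg_trans _ (cst sigma^-1 e @[e --> (0 : R)^'+])); last exact: cvg_cst.
apply: near_eq_cvg; near=> e.
have e0 : e != 0 by rewrite gt_eqF.
by rewrite /cst; field; rewrite e0 gt_eqF.
Unshelve. all: by end_near. Qed.

Lemma cvg_Bcoef : Bcoef dt e e sigma @[e --> 0^'+] --> (0 : R).
Proof.
rewrite [X in _ --> X](_ : 0 = sigma^-1 * (0 + 0)); last by rewrite addr0 mulr0.
apply: cvgM; first exact: cvg_eps_ratio.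
by apply: cvgD; [exact: cvg_expR_wexp|exact: cvg_average_wexp].
Qed.

Lemma cvg_Dcoef : Dcoef dt e e sigma @[e --> 0^'+] --> - sigma^-1.
Proof.
have -> : - sigma^-1 = - sigma^-1 * (1 + 0 + 2 * 0) by rewrite mulr0 !addr0 mulr1.
apply: cvgM; first by apply: cvgN; exact: cvg_eps_ratio.
apply: cvgD; first by apply: cvgD; [exact: cvg_cst|exact: cvg_expR_wexp].
by apply: cvgM; [exact: cvg_cst|exact: cvg_average_wexp].
Qed.

End coefficients.

(** * Asymptotic limit of the fluxes *)

Section fluxes.
Context (R : realType) (dx dt C : R) (WL WR : macro R).
Context (UL UR dUL dUR : R -> 'rV[R]_4) (ord : space_order).
Hypotheses (dx0 : 0 < dx) (dt0 : 0 < dt) (sigma0 : 0 < opacity_mid C WL WR).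

Lemma cvg_higher_order (psi : R -> R) :
  (if ord is SecondOrder then
     second_order_term dx dt C WL WR UL UR dUL dUR e e psi else 0)
  @[e --> 0^'+] --> (0 : R).
Proof.
case: ord; first exact: cvg_cst.
rewrite /second_order_term; move: (kin_int _) => a; move: (kin_int _) => b.
have lim0 : Acoef dt e e (opacity_mid C WL WR) * (dx / 2) * a
    + Bcoef dt e e (opacity_mid C WL WR) * b @[e --> (0 : R)^'+]
    --> 0 * (dx / 2) * a + 0 * b.
  apply: cvgD; (apply: cvgM; last exact: cvg_cst); last exact: cvg_Bcoef.
  by apply: cvgM; [exact: cvg_Acoef|exact: cvg_cst].
by rewrite !mul0r addr0 in lim0.
Qed.

(** Only the [D] term survives: [2 D / (3 dx)] tends to
[- 2 / (3 sigma dx)]. *)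
Lemma cvg_flux_rho :
  flux_rho dx dt C WL WR UL UR dUL dUR ord e e @[e --> 0^'+]
    --> limit_flux_rho dx C WL WR.
Proof.
rewrite /flux_rho /limit_flux_rho; set s := opacity_mid C WL WR.
move: (kin_int _) => a.
have -> : - (2 / (3 * s)) * ((q WR - q WL) / dx) =
    0 * a + 2 * - s^-1 / (3 * dx) * (q WR - q WL) + 0.
  by field; rewrite !gt_eqF.
apply: cvgD; last exact: cvg_higher_order.
apply: cvgD; apply: cvgM; try exact: cvg_cst; first exact: cvg_Acoef.
apply: cvgM; last exact: cvg_cst.
by apply: cvgM; [exact: cvg_cst|exact: cvg_Dcoef].
Qed.

Lemma cvg_flux_q :
  flux_q dx dt C WL WR UL UR dUL dUR ord e e @[e --> 0^'+]
    --> limit_flux_q dx C WL WR.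
Proof.
rewrite /flux_q /limit_flux_q; set s := opacity_mid C WL WR.
move: (kin_int _) => a.
set k := 5 * _ / _; set G := - (_ / _) + _.
have -> : - (2 / (3 * s)) * k *
    (- (1 / rho (mid WL WR) * ((rho WR - rho WL) / dx))
     + 2 / q (mid WL WR) * ((q WR - q WL) / dx)) =
    0 / 2 * a + 2 * - s^-1 / (3 * dx) * k * G + 0.
  (* with G folded, the interface means are not among the denominators that
     field has to clear *)
  have -> : - (1 / rho (mid WL WR) * ((rho WR - rho WL) / dx))
     + 2 / q (mid WL WR) * ((q WR - q WL) / dx) = G / dx by rewrite /G; ring.
  by field; rewrite !gt_eqF.
apply: cvgD; last exact: cvg_higher_order.
apply: cvgD; apply: cvgM; try exact: cvg_cst.
  by apply: cvgM; [exact: cvg_Acoef|exact: cvg_cst].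
apply: cvgM; last exact: cvg_cst.
apply: cvgM; last exact: cvg_cst.
by apply: cvgM; [exact: cvg_cst|exact: cvg_Dcoef].
Qed.

End fluxes.

(** * Consistency with the diffusion system *)

Section consistency.
Context (R : realType) (C : R) (W : R -> R -> macro R) (x y : R).
Hypotheses (C0 : 0 < C) (W0 : forall x' y', 0 < rho (W x' y') /\ 0 < q (W x' y')).
Hypotheses (drho : derivable (fun t : R => rho (W t y)) x 1)
           (dq : derivable (fun t : R => q (W t y)) x 1).

Let r0 : 0 < rho (W x y). Proof. by have [] := W0 x y. Qed.
Let q0 : 0 < q (W x y). Proof. by have [] := W0 x y. Qed.

Lemma cvg_opacity_mid :
  opacity_mid C (W (x - h / 2) y) (W (x + h / 2) y) @[h --> 0^'+]
    --> opacity C (W x y).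
Proof.
have [rP rN] := cvg_half_shift drho; have [qP qN] := cvg_half_shift dq.
by apply: cvg_mean; apply: cvg_opacity.
Qed.

Lemma cvg_diffusion_coef :
  - (2 / (3 * opacity_mid C (W (x - h / 2) y) (W (x + h / 2) y))) @[h --> 0^'+]
    --> - (2 / (3 * opacity C (W x y))).
Proof.
apply: cvgN; apply: cvgM; first exact: cvg_cst.
apply: cvgV; first by rewrite mulf_neq0// gt_eqF// opacity_gt0.
by apply: cvgM; [exact: cvg_cst|exact: cvg_opacity_mid].
Qed.

Lemma cvg_limit_flux_rho :
  limit_flux_rho h C (W (x - h / 2) y) (W (x + h / 2) y) @[h --> 0^'+]
    --> diffusion_flux_rho C W x y.
Proof.
rewrite /diffusion_flux_rho -mulNr.
by apply: cvgM; [exact: cvg_diffusion_coef|exact: cvg_central_diff dq].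
Qed.

(** The quotient rule, arranged as the bracket of [limit_flux_q]: a term in
[g'] followed by a term in [f']. *)
Lemma derive1_sqr_div (f g : R -> R) (a : R) :
  g a != 0 -> derivable f a 1 -> derivable g a 1 ->
  derive1 (fun t => f t ^+ 2 / g t) a =
    f a ^+ 2 / g a * (- (1 / g a * derive1 g a)) + 2 * f a / g a * derive1 f a.
Proof.
move=> ga df dg; rewrite !derive1E.
have := is_deriveM (is_deriveX 2 (derivableP df)) (is_deriveV ga (derivableP dg)).
move=> /@derive_val ->.
by rewrite /GRing.scale /= exprfctE; field.
Qed.

Lemma cvg_limit_flux_q :
  limit_flux_q h C (W (x - h / 2) y) (W (x + h / 2) y) @[h --> 0^'+]
    --> diffusion_flux_q C W x y.
Proof.
have [rP rN] := cvg_half_shift drho; have [qP qN] := cvg_half_shift dq.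
have rm : rho (mid (W (x - h / 2) y) (W (x + h / 2) y)) @[h --> 0^'+] --> rho (W x y).
  exact: cvg_mean.
have qm : q (mid (W (x - h / 2) y) (W (x + h / 2) y)) @[h --> 0^'+] --> q (W x y).
  exact: cvg_mean.
rewrite /diffusion_flux_q (derive1_sqr_div (negbT (gt_eqF r0)) dq drho).
set D := derive1 _ x; set E := derive1 _ x.
set r := rho (W x y); set p := q (W x y); set s := opacity C (W x y).
have -> : - (5 / 3 * (2 / (3 * s)) *
      (p ^+ 2 / r * - (1 / r * D) + 2 * p / r * E)) =
    - (2 / (3 * s)) * (5 * p ^+ 2 / (3 * r)) * (- (1 / r * D) + 2 / p * E).
  by field; rewrite !gt_eqF// opacity_gt0.
apply: cvgM; [apply: cvgM; first exact: cvg_diffusion_coef|].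
  apply: cvgM; first by apply: cvgM; [exact: cvg_cst|exact: cvg_comp qm (@exprn_continuous _ 2 _)].
  apply: cvgV; first by rewrite mulf_neq0// gt_eqF.
  by apply: cvgM => //; exact: cvg_cst.
apply: cvgD; [apply: cvgN|]; apply: cvgM.
- by apply: cvgM; [exact: cvg_cst|apply: cvgV => //; rewrite gt_eqF].
- exact: cvg_central_diff drho.
- by apply: cvgM; [exact: cvg_cst|apply: cvgV => //; rewrite gt_eqF].
- exact: cvg_central_diff dq.
Qed.

End consistency.

(** * Asymptotic preservation *)

Theorem mainTheorem1 (R : realType) (dx dy dt C : R)
  (hdx : 0 < dx) (hdy : 0 < dy) (hdt : 0 < dt) (hC : 0 < C)
  (W : int -> int -> macro R) (U dU : int -> int -> R -> 'rV[R]_4)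
  (hU : forall i j v, 0 <= v -> realizable (U i j v))
  (hW : forall i j, 0 < rho (W i j) /\ 0 < q (W i j))
  (hsigma : exists M : R, forall i j, opacity C (W i j) <= M) :
  (forall (ord : space_order) (i j : int),
     finite_flux_moments (U i j) (U (i + 1) j) (dU i j) (dU (i + 1) j) ord ->
     flux_rho dx dt C (W i j) (W (i + 1) j)
        (U i j) (U (i + 1) j) (dU i j) (dU (i + 1) j) ord eps eps
       @[eps --> 0^'+] --> limit_flux_rho dx C (W i j) (W (i + 1) j)
     /\
     flux_q dx dt C (W i j) (W (i + 1) j)
        (U i j) (U (i + 1) j) (dU i j) (dU (i + 1) j) ord eps eps
       @[eps --> 0^'+] --> limit_flux_q dx C (W i j) (W (i + 1) j))
  /\
  consistent_x (fun h WL WR => limit_flux_rho h C WL WR) (diffusion_flux_rho C)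
  /\
  consistent_x (fun h WL WR => limit_flux_q h C WL WR) (diffusion_flux_q C).
Proof.
split; last by split=> V x y V0 drho dq;
  [exact: cvg_limit_flux_rho|exact: cvg_limit_flux_q].
move=> ord i j _.
have [rL qL] := hW i j; have [rR qR] := hW (i + 1) j.
have s0 : 0 < opacity_mid C (W i j) (W (i + 1) j).
  by rewrite divr_gt0// addr_gt0// opacity_gt0.
by split; [exact: cvg_flux_rho|exact: cvg_flux_q].
Qed.
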